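(* Let $n \ge 2$. There is a one-to-one correspondence between the determined positions in generalized Ayo on a board with $2n$ pits (numbered $-n+2, -n+1, \ldots, n, n+1$) and the winnable positions in Tchoukaillon on a board with $n+1$ pits (numbered $1, 2, \ldots, n+1$). The Tchoukaillon position corresponding to a determined Ayo position is obtained by ignoring the pits $0, -1, -2, \ldots, -n+2$, i.e. by keeping only the contents of the pits $1, 2, \ldots, n+1$.
   Context: **Generalized Ayo.** The board has $2n$ pits arranged in a circuit and numbered clockwise $-n+2, -n+1, \ldots, -1, 0, 1, \ldots, n, n+1$. There are two players, S (South), whose side consists of pits $2, \ldots, n+1$, and N (North), whose side consists of pits $-n+2, \ldots, 1$. An arbitrary arrangement of stones is allowed as a position. A position also records which player is to move. Players alternate moves. *Movement.* A player chooses a non-empty pit on his or her own side, removes all its stones, and sows them one per pit, starting with the next pit and proceeding counterclockwise, i.e. from higher numbered pits to lower numbered pits, and from pit $-n+2$ to pit $n+1$. A pit containing $2n$ or more stones is an Odu. If an Odu is chosen, sowing proceeds as usual except that the initial pit is skipped on each circuit of the board. *Capture.* If the last pit sown by a player is on the opponent's side and contains, after having been sown, two or three stones, then the stones in this pit are captured. Also captured are stones in the consecutively preceding pits which meet these conditions. *End of game.* At each turn a player must, if possible, move so that the opponent has a legal move. If a player cannot do so, the game is over and that player is awarded all remaining stones. If there are so few stones on the board that neither player can ever capture but both players will always have a legal move, the game is over and each player is awarded the stones on his or her own side. **Determined position.** A determined position is an arrangement of stones on the generalized Ayo board where it is possible for S to move such that: (i) S captures at every turn; (ii) there is no move from an Odu;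 (iii) after every turn, N has only one stone on his side of the board; (iv) all stones are captured by S except one, which is awarded to N. Here condition (iii) is also understood to apply to the given position itself, so that N's side contains exactly one stone in a determined position. Determined play is regarded as continuing until the board is empty except for a single stone in pit $0$ with S to move, and this last stone is awarded to N. This terminal position counts as a determined position. **Tchoukaillon.** This is a solitaire game on a row of pits numbered $1, 2, 3, \ldots$ (here $1, \ldots, n+1$), each containing some number of stones, together with an additional pit, the Roumba, which may be regarded as pit $0$. A move consists of harvesting a pit $i$. Pit $i$ may be harvested if and only if it contains exactly $i$ stones ($i \ge 1$). Its $i$ stones are removed and one stone is placed in each of the pits $i-1, i-2, \ldots, 1$ and one in the Roumba. The game is won if all stones have been put in the Roumba. A position is winnable if a win is possible from it. The position with no stones in the pits is winnable. *)

(* Defs.v *)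
From mathcomp Require Import all_boot all_algebra.

Set Implicit Arguments.
Unset Strict Implicit.
Unset Printing Implicit Defensive.

Section Ayo.

Variable n : nat.

(* The ordinals run around the circuit in clockwise order, starting at the pit
   numbered -n+2; so ord_pred is one step of counterclockwise sowing, and it
   wraps from pit -n+2 to pit n+1. *)
Definition pit := 'I_n.*2.

Definition label (i : pit) : int := ((i : nat)%:Z - n%:Z + 2)%R.

Definition board := {ffun pit -> nat}.

Inductive player := South | North.

Definition other (P : player) : player :=
  match P with South => North | North => South end.

Definition owns (P : player) (i : pit) : bool :=
  match P with
  | South => (2 <= label i)%R
  | North => (label i <= 1)%R
  end.

(* The player to move, and the arrangement of the stones. *)
Definition position := (player * board)%type.

(* Labels are pairwise distinct, so this is the content of the pit
   numbered k. *)
Definition content (b : board) (k : int) : nat := \sum_(i | label i == k) b i.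

Definition stones (b : board) : nat := \sum_i b i.

Definition side_stones (P : player) (b : board) : nat := \sum_(i | owns P i) b i.

Definition odu (b : board) (o : pit) : bool := n.*2 <= b o.

(* The initial pit o is skipped on each circuit; with fewer than 2n stones the
   sowing does not get back to o, so the skip affects only an Odu. *)
Definition next_pit (o i : pit) : pit :=
  if ord_pred i == o then ord_pred o else ord_pred i.

Definition sowing (b : board) (o : pit) : seq pit :=
  traject (next_pit o) (next_pit o o) (b o).

Definition sow (b : board) (o : pit) : board :=
  [ffun i => (if i == o then 0 else b i) + count_mem i (sowing b o)].

Definition capturable (P : player) (b : board) (o i : pit) : bool :=
  owns (other P) i && (sow b o i \in [:: 2; 3]).

(* i is captured when the last pit sown, i, and all pits in between are
   capturable; the pits preceding the last one are met by going clockwise. *)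
Definition captured (P : player) (b : board) (o i : pit) : bool :=
  let last_pit := last o (sowing b o) in
  [exists m : pit, (i == iter m (@ordS _) last_pit)
    && [forall k : pit, (k <= m) ==>
         capturable P b o (iter k (@ordS _) last_pit)]].

Definition capture_count (P : player) (b : board) (o : pit) : nat :=
  \sum_(i | captured P b o i) sow b o i.

Definition after_move (P : player) (b : board) (o : pit) : board :=
  [ffun i => if captured P b o i then 0 else sow b o i].

Definition available (P : player) (b : board) (o : pit) : bool :=
  owns P o && (0 < b o).

Definition feeds (P : player) (b : board) (o : pit) : bool :=
  [exists q, available (other P) (after_move P b o) q].

(* A player must, if possible, leave the opponent a move.  When this is
   impossible the game is over by the rules; determined play goes on
   nevertheless, down to the final board, so no move is excluded then. *)
Definition legal (P : player) (b : board) (o : pit) : bool :=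
  available P b o
  && (feeds P b o || ~~ [exists q, available P b q && feeds P b q]).

Definition final_board : board := [ffun i => (label i == 0%R : nat)].

(* From the given position S can play, against all replies of N, so that S
   captures at every turn, no move is made from an Odu, N's side contains one
   stone before and after every turn, and the final board is reached with S to
   move and with s stones captured by S on the way. *)
Inductive determined_play : position -> nat -> Prop :=
| play_end : determined_play (South, final_board) 0
| play_South b o s :
    side_stones North b = 1 ->
    legal South b o ->
    ~~ odu b o ->
    0 < capture_count South b o ->
    determined_play (North, after_move South b o) s ->
    determined_play (South, b) (capture_count South b o + s)
| play_North b s :
    side_stones North b = 1 ->
    (forall o, legal North b o ->
       ~~ odu b o /\ determined_play (South, after_move North b o) s) ->
    determined_play (North, b) s.

(* All stones but one are captured by S; the remaining one, which is alone on
   the final board, is awarded to N.  Either player may be to move. *)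
Definition determined (x : position) : Prop :=
  exists2 s, determined_play x s & stones x.2 = s + 1.

End Ayo.

Section Tchoukaillon.

Variable n : nat.

(* The ordinal j stands for the pit numbered j + 1; the content of the Roumba
   is not part of a position. *)
Definition tboard := {ffun 'I_n.+1 -> nat}.

Definition harvestable (t : tboard) (j : 'I_n.+1) : bool := t j == j.+1.

(* Of the stones removed, the one missing from the result goes to the
   Roumba. *)
Definition harvest (t : tboard) (j : 'I_n.+1) : tboard :=
  [ffun k => if k == j then 0 else if k < j then (t k).+1 else t k].

Inductive winnable : tboard -> Prop :=
| win_empty : winnable [ffun=> 0]
| win_harvest t j : harvestable t j -> winnable (harvest t j) -> winnable t.

End Tchoukaillon.

Definition tchoukaillon_part (n : nat) (x : position n) : tboard n :=
  [ffun j : 'I_n.+1 => content x.2 (j : nat).+1%:Z].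

(* Main.v *)
Require Import Defs.
From mathcomp Require Import all_boot all_algebra.
From mathcomp Require Import classical_sets functions.
From mathcomp Require Import zify.

(** The stone on North's side determines everything.  When South captures
    without moving from an Odu, the sowing is shorter than one circuit and ends
    at a pit p of North's side.  The final content of p is two or three, so p is
    where North's only stone was, and it ends with exactly two.  The next pit
    clockwise is not captured: it is on South's side, or it has just received
    its only stone.  After the capture, North's stones are one in each of the
    pits p+1, ..., 1.

    For play to go on, that must be a single stone which North brings back to
    a place from which the argument can be repeated.  Going backwards from the
    final board, where the stone is in pit 0, one finds that North's stone is
    in pit 0 whenever South is to move and in pit 1 whenever North is to move.
    South's capturing moves are then the harvests of pits i >= 2 (i stones are
    sown in i-1, ..., 0, and pit 0 is emptied by the capture), and North's only
    move is the harvest of pit 1.  So determined play projects onto a won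
    Tchoukaillon game ([determined_play_winnable]).

    This also gives the inverse of the projection.  In a winnable position
    pit 1 has at most one stone, since no pit can hold more stones than its
    number.  If it has one then North is to move and there is nothing else on
    his side; if it is empty then South is to move and North's stone is in
    pit 0 ([ayo_position]).  Each harvest of a won game lifts to a move of
    determined play ([winnable_determined]): a harvest of pit i >= 2 is only
    possible while pit 1 is empty, that is, when it is South's turn.

    Below, pits are addressed by their ordinals: the pit numbered k is the
    ordinal k + n - 2, so that pits 0, 1 and 2 are n.-2, n.-1 and n, the side of
    North is i < n, and sowing goes down. *)

Set Implicit Arguments.
Unset Strict Implicit.
Unset Printing Implicit Defensive.

(** * Sides and labels *)

Section Board.

Variable n : nat.
Implicit Types (P : player) (b : board n) (o i : pit n) (t : tboard n).

Lemma owns_South i : owns South i = (n <= i).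
Proof. by rewrite /owns /label; lia. Qed.

Lemma owns_North i : owns North i = (i < n).
Proof. by rewrite /owns /label; lia. Qed.

Lemma contentE b k i : label i = k -> content b k = b i.
Proof.
move=> <-; rewrite /content (big_pred1 i) // => j /=.
by rewrite -val_eqE /label /=; lia.
Qed.

(** * Sowing less than a circuit *)

Lemma val_ord_pred_gt0 i : 0 < i -> ord_pred i = i.-1 :> nat.
Proof.
move=> i_gt0; rewrite /= -subn1 addnC -addnBA // modnDl modn_small; first by lia.
by have := ltn_ord i; lia.
Qed.

Lemma val_ord_pred0 i : i = 0 :> nat -> ord_pred i = n.*2.-1 :> nat.
Proof.
by move=> i0; rewrite /= i0 add0n modn_small //; have := ltn_ord i; lia.
Qed.

(** Within one circuit the sowing does not come back to the initial pit, so the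
    skip in [next_pit] has no effect. *)
Lemma iter_next_pit o k : k <= o -> iter k (next_pit o) o = o - k :> nat.
Proof.
elim: k => [|k IHk] lt_ko; first by rewrite subn0.
have predE : ord_pred (iter k (next_pit o) o) = o - k.+1 :> nat.
  by rewrite val_ord_pred_gt0 IHk; lia.
rewrite iterS {1}/next_pit ifF ?predE //.
by rewrite -val_eqE; move: predE => /= ->; lia.
Qed.

Lemma iter_next_pit_wrap o k :
  o < k < n.*2 -> iter k (next_pit o) o = o + n.*2 - k :> nat.
Proof.
elim: k => // k IHk /andP[le_ok lt_kn].
have predE : ord_pred (iter k (next_pit o) o) = o + n.*2 - k.+1 :> nat.
  have [eq_ok|ne_ok] := eqVneq (o : nat) k.
    by rewrite val_ord_pred0 ?iter_next_pit; lia.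
  by rewrite val_ord_pred_gt0 IHk; lia.
rewrite iterS {1}/next_pit ifF ?predE //.
by rewrite -val_eqE; move: predE => /= ->; lia.
Qed.

Lemma last_sowing b o : last o (sowing b o) = iter (b o) (next_pit o) o.
Proof. by rewrite /sowing last_traject. Qed.

Lemma sow_no_wrap b o i : b o <= o ->
  sow b o i = (if i == o then 0 else b i) + (o - b o <= i < o).
Proof.
rewrite /sow ffunE /sowing => le_bo; congr (_ + _).
elim: (b o) le_bo => [|k IHk] lt_ko; first by rewrite /= subn0; lia.
rewrite trajectSr -cats1 count_cat IHk /=; last by lia.
by rewrite -iterSr -val_eqE /= -iterS iter_next_pit //; lia.
Qed.

(** * Conservation of stones *)

Lemma stones_sow b o : stones (sow b o) = stones b.
Proof.
rewrite /stones (eq_bigr _ (fun i _ => ffunE _ i)) big_split /=.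
have -> : \sum_i count_mem i (sowing b o) = b o.
  transitivity (size (sowing b o)); last by rewrite size_traject.
  elim: (sowing b o) => [|x s IHs] /=; first by rewrite big1.
  rewrite big_split /= IHs (bigD1 x) //= eqxx big1 // => i /negbTE.
  by rewrite eq_sym => ->.
rewrite [RHS](bigD1 o) //= [in LHS](bigD1 o) //= eqxx addnC add0n.
by congr (_ + _); apply: eq_bigr => i /negbTE ->.
Qed.

Lemma stones_after_move P b o :
  stones b = capture_count P b o + stones (after_move P b o).
Proof.
rewrite -(stones_sow b o) /stones /capture_count (bigID (captured P b o)) /=.
congr (_ + _); rewrite [RHS](bigID (captured P b o)) /=.
rewrite [X in _ = X + _]big1 ?add0n.
  by apply: eq_bigr => i /negbTE nci; rewrite [RHS]ffunE nci.
by move=> i ci; rewrite [LHS]ffunE ci.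
Qed.

(** * Captures *)

(** The chain of captures starts at the last pit sown, so if this pit cannot be
    captured then nothing is. *)
Lemma captured_last P b o i :
  captured P b o i -> capturable P b o (last o (sowing b o)).
Proof.
case/existsP=> m /andP[_ /forallP all_m].
have n2_gt0 : 0 < n.*2 by have := ltn_ord i; lia.
exact: (implyP (all_m (Ordinal n2_gt0))).
Qed.

Lemma capture_count_last P b o :
  0 < capture_count P b o -> capturable P b o (last o (sowing b o)).
Proof.
apply: contraTT => ncap; rewrite -leqNgt leqn0 /capture_count big_pred0 // => i.
by apply: contraNF ncap; apply: captured_last.
Qed.

(** In determined play South takes from a single pit, because the next pit in the
    chain already fails to meet the conditions. *)
Lemma captured_single P b o i :
    capturable P b o (last o (sowing b o)) ->
    ~~ capturable P b o (ordS (last o (sowing b o))) ->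
  captured P b o i = (i == last o (sowing b o)).
Proof.
have n2_gt0 : 0 < n.*2 by have := ltn_ord i; lia.
have n2_gt1 : 1 < n.*2 by lia.
set l := last _ _ => capl ncapl.
apply/existsP/eqP => [[m /andP[/eqP-> /forallP all_m]]|->].
  case: m all_m => [[//|m] lt_m] /(_ (Ordinal n2_gt1)) /=.
  by rewrite (negbTE ncapl).
exists (Ordinal n2_gt0); rewrite eqxx; apply/forallP=> k.
by apply/implyP => /=; rewrite leqn0 => /eqP->.
Qed.

(** * Boards with one stone on North's side *)

(** The contents of South's side are left free.  The place p is a number rather
    than a pit, so that it can be n.-1 or n.-2 without a proof of its bound. *)
Definition lone_stone b (p : nat) := forall i, i < n -> b i = (i == p :> nat).

Lemma side_stones_North1 b : side_stones North b = 1 ->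
  exists2 p : pit n, p < n & lone_stone b p.
Proof.
move/eqP/sum_nat_eq1 => [p [own_p bp1 b0]].
exists p; first by rewrite -owns_North.
move=> i lt_in.
have [/val_inj->|ne_ip] := eqVneq (i : nat) p; first exact: bp1.
by apply/b0; rewrite ?owns_North.
Qed.

Lemma lone_stone_side b (p : pit n) :
  p < n -> lone_stone b p -> side_stones North b = 1.
Proof.
move=> lt_pn lone; rewrite /side_stones (bigD1 p) ?owns_North // lone // eqxx.
rewrite big1 // => i /andP[]; rewrite owns_North => lt_in ne_ip.
by rewrite lone // val_eqE (negbTE ne_ip).
Qed.

(** A sowing that wraps around but is shorter than a circuit ends above its
    initial pit, on South's side, where South captures nothing.  Without
    wrapping, the last pit gains one stone; it can only reach two or three if it
    held North's stone. *)
Lemma South_capture_reach b o (p : pit n) :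
    p < n -> lone_stone b p -> available South b o -> ~~ odu b o ->
  0 < capture_count South b o -> b o = o - p.
Proof.
move=> lt_pn lone /andP[]; rewrite owns_South => le_no bo_gt0.
rewrite /odu -ltnNge => bo_lt /capture_count_last.
rewrite last_sowing; set l := iter _ _ _; rewrite /capturable => /andP[].
rewrite owns_North => lt_ln.
have [le_bo|lt_ob] := leqP (b o) o; last first.
  by have := iter_next_pit_wrap (k := b o) (o := o); rewrite -/l; lia.
have lE : l = o - b o :> nat by rewrite iter_next_pit.
rewrite sow_no_wrap // ifF; last by rewrite -val_eqE /=; lia.
rewrite lone // !inE; lia.
Qed.

(** The pits above p on North's side were empty before the sowing and hold
    one stone after it, which stops the chain of captures at p. *)
Lemma South_captured b o (p : pit n) i :
    p < n -> lone_stone b p -> n <= o -> b o = o - p ->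
  captured South b o i = (i == p).
Proof.
move=> lt_pn lone le_no boE.
have lE : last o (sowing b o) = p.
  by apply: val_inj; rewrite /= last_sowing iter_next_pit boE; lia.
rewrite captured_single lE //.
  rewrite /capturable owns_North lt_pn sow_no_wrap ?boE; last by lia.
  by rewrite ifF -?val_eqE ?lone // ?inE /=; lia.
rewrite /capturable owns_North.
have Sp : ordS p = p.+1 :> nat by rewrite /= modn_small; lia.
move: (ordS p) Sp => q qE; apply/negP=> /andP[lt_qn].
rewrite sow_no_wrap ?boE; last by lia.
by rewrite ifF -?val_eqE ?lone // ?inE /=; lia.
Qed.

Lemma South_after b o (p : pit n) i :
    p < n -> lone_stone b p -> n <= o -> b o = o - p ->
  after_move South b o i =
    if i == p then 0 else (if i == o then 0 else b i) + (p <= i < o).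
Proof.
move=> lt_pn lone le_no boE.
rewrite ffunE (South_captured i lt_pn lone) //; case: eqP => // _.
by rewrite sow_no_wrap ?boE; last (by lia); congr (_ + _); lia.
Qed.

(** North's stone stays on his own side, and captures are made on the other. *)
Lemma North_capture0 b o : b o = 1 -> 0 < o < n -> capture_count North b o = 0.
Proof.
move=> bo1 /andP[o_gt0 lt_on]; apply/eqP; rewrite -leqn0 leqNgt.
apply/negP=> /capture_count_last; rewrite /capturable last_sowing => /andP[].
by rewrite owns_South iter_next_pit bo1; lia.
Qed.

Lemma North_after b o i : b o = 1 -> 0 < o < n ->
  after_move North b o i = (if i == o then 0 else b i) + (i == o.-1 :> nat).
Proof.
move=> bo1 lt_on; rewrite ffunE ifF.
  by rewrite sow_no_wrap bo1; [congr (_ + _); lia | lia].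
apply/negbTE/negP=> /(@captured_last _ _ _ _).
rewrite /capturable last_sowing => /andP[].
by rewrite owns_South iter_next_pit bo1; lia.
Qed.

(** The duty to feed the opponent cannot exclude the only available move. *)
Lemma lone_stone_legal b o : o < n -> lone_stone b o -> legal North b o.
Proof.
move=> lt_on lone; have av q : available North b q = (q == o).
  rewrite /available owns_North -val_eqE /=.
  by case: ltnP => [lt_qn|le_nq] /=; [rewrite lone //|]; lia.
rewrite /legal av eqxx /= -implyNb; apply/implyP=> nfeeds.
apply/negP=> /existsP[q]; rewrite av => /andP[/eqP-> fo].
by rewrite fo in nfeeds.
Qed.

(** * Lifting Tchoukaillon positions to the Ayo board *)

Hypothesis n_gt1 : 1 < n.

(** Where North's stone is in determined play: the ordinal of pit 0 when South
    is to move, and of pit 1 when North is. *)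
Definition north_pit P : nat := if P is South then n.-2 else n.-1.

Lemma tchoukaillon_partE (x : position n) (j : 'I_n.+1) i :
  i = j + n.-1 :> nat -> tchoukaillon_part x j = x.2 i.
Proof. by move=> ij; rewrite ffunE (@contentE _ _ i) // /label; lia. Qed.

Lemma pit_at (k : nat) : k < n.*2 -> exists i : pit n, i = k :> nat.
Proof. by move=> lt_k; exists (Ordinal lt_k). Qed.

(** Pit 0 gets a stone exactly when pit 1 has none, so that North's side always
    has one when t is winnable. *)
Definition ayo_position t : position n :=
  (if t ord0 == 0 then South else North,
   [ffun i : pit n =>
     if i < n.-1 then ((i == n.-2 :> nat) && (t ord0 == 0) : nat)
     else t (inord (i - n.-1))]).

Lemma ayo_positionK t : tchoukaillon_part (ayo_position t) = t.
Proof.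
apply/ffunP=> j; have ltj := ltn_ord j.
have [|i ij] := @pit_at (j + n.-1); first by lia.
by rewrite (tchoukaillon_partE _ ij) ffunE ij ifF ?addnK ?inord_val //; lia.
Qed.

Lemma ayo_position_lone t : t ord0 <= 1 ->
  lone_stone (ayo_position t).2 (north_pit (ayo_position t).1).
Proof.
move=> t0 i lt_in; rewrite ffunE /=.
case: ltnP => [lt_i|le_i]; first by case: (t ord0) t0 => [|[|//]] _ /=; lia.
have -> : i - n.-1 = 0 by lia.
have -> : inord 0 = ord0 :> 'I_n.+1 by apply: val_inj; rewrite /= inordK.
by case: (t ord0) t0 => [|[|//]] _ /=; lia.
Qed.

Lemma tchoukaillon_partK (x : position n) :
  lone_stone x.2 (north_pit x.1) -> ayo_position (tchoukaillon_part x) = x.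
Proof.
case: x => P b /= lone; have [|i1 i1E] := @pit_at n.-1; first by lia.
have t0 : tchoukaillon_part (P, b) ord0 = (if P is South then 0 else 1).
  rewrite (@tchoukaillon_partE _ _ i1) //= lone ?i1E; last by lia.
  by case: P {lone} => /=; lia.
rewrite /ayo_position t0; congr (_, _); first by case: P {lone t0}.
apply/ffunP=> i; rewrite ffunE; case: ltnP => [lt_i|le_i].
  by rewrite lone; [case: P {lone t0} => /=; lia | lia].
have lti := ltn_ord i; rewrite (@tchoukaillon_partE _ _ i) // inordK; lia.
Qed.

(** * Moves as harvests *)

(** A sowing from pit i that ends at pit 0 uses i stones, as the harvest of pit i
    requires; the stone sown in pit 0, which the harvest puts in the Roumba, is
    captured together with North's, and the one sown in pit 1 becomes North's
    only stone. *)
Lemma South_harvest P P' b o (j : 'I_n.+1) :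
    lone_stone b n.-2 -> n <= o -> b o = o - n.-2 -> o = j + n.-1 :> nat ->
  [/\ harvestable (tchoukaillon_part (P, b)) j,
      tchoukaillon_part (P', after_move South b o)
        = harvest (tchoukaillon_part (P, b)) j
    & lone_stone (after_move South b o) n.-1].
Proof.
move=> lone le_no boE oj; have [|p pE] := @pit_at n.-2; first by lia.
rewrite -pE in lone boE; have lt_pn : p < n by lia.
have aE := South_after _ lt_pn lone le_no boE.
split; first by rewrite /harvestable (@tchoukaillon_partE _ _ o) //=; lia.
  apply/ffunP=> k; have ltk := ltn_ord k.
  have [|i ik] := @pit_at (k + n.-1); first by lia.
  rewrite (tchoukaillon_partE _ ik) /= aE /harvest ffunE.
  rewrite (tchoukaillon_partE _ ik) /= -!val_eqE /=.
  by do ![case: ifP]; lia.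
move=> i lt_in; rewrite aE -!val_eqE /= lone //.
by do ![case: ifP]; lia.
Qed.

Lemma North_harvest P P' b o : lone_stone b n.-1 -> o = n.-1 :> nat ->
  [/\ harvestable (tchoukaillon_part (P, b)) ord0,
      tchoukaillon_part (P', after_move North b o)
        = harvest (tchoukaillon_part (P, b)) ord0
    & lone_stone (after_move North b o) n.-2].
Proof.
move=> lone oE; have bo1 : b o = 1 by rewrite lone ?oE ?eqxx //; lia.
have lt_o : 0 < o < n by lia.
have aE := North_after _ bo1 lt_o.
split; first by rewrite /harvestable (@tchoukaillon_partE _ _ o) //=; lia.
  apply/ffunP=> k; have ltk := ltn_ord k.
  have [|i ik] := @pit_at (k + n.-1); first by lia.
  rewrite (tchoukaillon_partE _ ik) /= aE /harvest ffunE.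
  rewrite (tchoukaillon_partE _ ik) /= -!val_eqE /=.
  by do ![case: ifP]; lia.
move=> i lt_in; rewrite aE -!val_eqE /= lone //.
by do ![case: ifP]; lia.
Qed.

(** Stones only enter pit i in a harvest of a higher pit, and leave it when there
    are exactly i of them; a pit with more could never be emptied. *)
Lemma winnable_bound t j : winnable t -> t j <= j.+1.
Proof.
elim=> [|{}t k /eqP tk _]; first by rewrite ffunE.
rewrite ffunE; case: eqVneq => [->|_]; first by rewrite tk.
by case: ifP; lia.
Qed.

(** South's capture at p leaves stones in the pits from p+1 to pit 1.  Pit 1 has
    one, so p is not pit 1, and pit 0 has none, so p is not below pit 0. *)
Lemma South_capture_at_0 b o :
    side_stones North b = 1 -> available South b o -> ~~ odu b o ->
    0 < capture_count South b o -> lone_stone (after_move South b o) n.-1 ->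
  lone_stone b n.-2 /\ b o = o - n.-2.
Proof.
move=> /side_stones_North1[p lt_pn lone] av nodu cap alone.
have boE := South_capture_reach lt_pn lone av nodu cap.
move: av => /andP[]; rewrite owns_South => le_no _.
have aE := South_after _ lt_pn lone le_no boE.
suff pE : p = n.-2 :> nat by rewrite -pE.
have := aE p; rewrite eqxx alone // => pn1.
have [|z zE] := @pit_at n.-2; first by lia.
have := aE z; rewrite alone -?val_eqE /= ?zE; last by lia.
by case: ifP; lia.
Qed.

(** If North's stone is in the lowest pit, it is sown on South's side and
    leaves nothing in pit 0. *)
Lemma North_moves_from_1 b o : lone_stone b o -> o < n ->
  lone_stone (after_move North b o) n.-2 -> o = n.-1 :> nat.
Proof.
move=> lone lt_on alone; have bo1 : b o = 1 by rewrite lone // eqxx.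
have [|z zE] := @pit_at n.-2; first by lia.
have : after_move North b o z = 1 by rewrite alone ?zE ?eqxx //; lia.
case: (posnP o) => [o0|o_gt0].
  rewrite ffunE; case: ifP => _; first by lia.
  have lastE : next_pit o o = n.*2.-1 :> nat.
    by rewrite (@iter_next_pit_wrap o 1); lia.
  rewrite ffunE /sowing bo1 /= -!val_eqE /= lastE lone ?zE; last by lia.
  by case: ifP; lia.
by rewrite North_after ?bo1 ?o_gt0 // lone -?val_eqE /=; do ?case: ifP; lia.
Qed.

(** * The correspondence *)

(** That all stones but one are captured by S is carried through each turn by the
    conservation of stones. *)
Lemma determined_South b o :
    lone_stone b n.-2 -> n <= o -> b o = o - n.-2 ->
    determined (North, after_move South b o) -> determined (South, b).
Proof.
move=> lone le_no boE [s play stE]; have lto := ltn_ord o.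
have [|p pE] := @pit_at n.-2; first by lia.
rewrite -pE in lone boE; have lt_pn : p < n by lia.
have aE := South_after _ lt_pn lone le_no boE.
exists (capture_count South b o + s); last first.
  by rewrite /= (stones_after_move South b o) stE addnA.
apply: play_South => //.
- exact: lone_stone_side lone.
- rewrite /legal /available owns_South le_no boE.
  apply/andP; split; first by lia.
  (* The capture leaves North a stone in pit 1. *)
  apply/orP; left; apply/existsP; have [|q qE] := @pit_at n.-1; first by lia.
  exists q; rewrite /available owns_North aE -!val_eqE /=.
  by do ![case: ifP]; lia.
- by rewrite /odu boE; lia.
rewrite /capture_count (bigD1 p) ?(South_captured _ lt_pn lone) //=.
rewrite sow_no_wrap ?boE; last by lia.
by case: ifP; rewrite ?lone //; lia.
Qed.

Lemma determined_North b o :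
    lone_stone b n.-1 -> o = n.-1 :> nat ->
    determined (South, after_move North b o) -> determined (North, b).
Proof.
move=> lone oE [s play stE]; rewrite -oE in lone; have lt_on : o < n by lia.
have bo1 : b o = 1 by rewrite lone // eqxx.
exists s; last by rewrite /= (stones_after_move North b o) North_capture0 //; lia.
apply: play_North => [|q /andP[/andP[]]]; first exact: lone_stone_side lone.
rewrite owns_North => lt_qn; rewrite lone // => qo _.
have -> : q = o by apply: val_inj => /=; lia.
by split=> //; rewrite /odu bo1; lia.
Qed.

Lemma tchoukaillon_part_final :
  tchoukaillon_part (South, final_board n) = [ffun=> 0].
Proof.
apply/ffunP=> j; have ltj := ltn_ord j.
have [|i ij] := @pit_at (j + n.-1); first by lia.
by rewrite (tchoukaillon_partE _ ij) !ffunE /label; lia.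
Qed.

Lemma final_board_lone : lone_stone (final_board n) n.-2.
Proof. by move=> i lt_in; rewrite ffunE /label; lia. Qed.

Lemma determined_play_winnable (x : position n) s : determined_play x s ->
  winnable (tchoukaillon_part x) /\ lone_stone x.2 (north_pit x.1).
Proof.
(* The generated induction principle has no hypothesis for the plays that are
   inside the conjunction of [play_North], hence the explicit recursion. *)
move: x s; fix IH 3 => x s play.
destruct play as [|b o s side1 leg nodu cap play|b s side1 play].
- rewrite tchoukaillon_part_final.
  by split; [exact: win_empty | exact: final_board_lone].
- have [win alone] := IH _ _ play; have /andP[av _] := leg.
  have [lone boE] := South_capture_at_0 side1 av nodu cap alone.
  move: av => /andP[]; rewrite owns_South => le_no _.
  have lto := ltn_ord o; have [j oj] : exists j : 'I_n.+1, o = j + n.-1 :> nat.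
    have lt_j : o - n.-1 < n.+1 by lia.
    by exists (Ordinal lt_j) => /=; lia.
  have [harv partE _] := South_harvest South North lone le_no boE oj.
  by split=> //; apply: win_harvest harv _; rewrite -partE.
- have [p lt_pn lone] := side_stones_North1 side1.
  (* A bare match, through which the guard condition sees the subterm. *)
  destruct (play p (lone_stone_legal lt_pn lone)) as [_ playS].
  have [win alone] := IH _ _ playS.
  have pE := North_moves_from_1 lone lt_pn alone; rewrite pE in lone.
  have [harv partE _] := North_harvest North South lone pE.
  by split=> //; apply: win_harvest harv _; rewrite -partE.
Qed.

(** A harvest of pit 1 is lifted to a move of North.  A harvest of a higher pit
    adds a stone to pit 1, which must have been empty by [winnable_bound]; hence
    it is lifted to a move of South. *)
Lemma winnable_determined t : winnable t -> determined (ayo_position t).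
Proof.
elim=> [|{}t j harv win det].
  rewrite -tchoukaillon_part_final tchoukaillon_partK;
    last exact: final_board_lone.
  exists 0; first exact: play_end.
  have [|i i0] := @pit_at n.-2; first by lia.
  rewrite /stones (bigD1 i) //= ffunE /label big1 => [|k]; first by lia.
  by rewrite ffunE /label -val_eqE /=; lia.
have t0 : t ord0 <= 1 by apply: winnable_bound (win_harvest harv win).
have lone := ayo_position_lone t0.
have partE := ayo_positionK t.
have ltj := ltn_ord j; have [|o oj] := @pit_at (j + n.-1); first by lia.
have bo : (ayo_position t).2 o = j.+1.
  by rewrite -(tchoukaillon_partE _ oj) partE; apply/eqP.
have [j0|j_gt0] := posnP j.
  have {}j0 : j = ord0 by apply: val_inj.
  subst j; have [b Et] : exists b, ayo_position t = (North, b).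
    by rewrite /ayo_position (eqP harv); eexists.
  rewrite Et /= in lone partE bo *.
  have [_ harvE alone] := North_harvest North South lone oj.
  apply: (determined_North lone oj).
  by rewrite -[X in determined X](tchoukaillon_partK) // harvE partE.
have [b Et] : exists b, ayo_position t = (South, b).
  have := winnable_bound ord0 win.
  rewrite ffunE -val_eqE /= ifF ?j_gt0; last by lia.
  by rewrite /ayo_position; case: eqP => [_|]; [eexists | lia].
rewrite Et /= in lone partE bo *.
have le_no : n <= o by lia.
have boE : b o = o - n.-2 by lia.
have [_ harvE alone] := South_harvest South North lone le_no boE oj.
apply: (determined_South lone le_no boE).
by rewrite -[X in determined X](tchoukaillon_partK) // harvE partE.
Qed.

End Board.

Theorem theorem3 (n : nat) (hn : 2 <= n) :
  set_bij (@determined n) (@winnable n) (@tchoukaillon_part n).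
Proof.
split.
- by move=> x [s /(determined_play_winnable hn)[]].
- move=> x y /set_mem[s /(determined_play_winnable hn)[_ lonex] _].
  move=> /set_mem[s' /(determined_play_winnable hn)[_ loney] _] e.
  by rewrite -(tchoukaillon_partK hn lonex) e (tchoukaillon_partK hn loney).
- move=> t win; exists (ayo_position t); first exact: winnable_determined.
  exact: (ayo_positionK hn).
Qed.
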